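(* Let $u$ be a global flow--Lax admissible solution and let $b_t=b_j(t)$ be one of its point channels. Let $\lambda_t>0$, $Y_t,\xi_t,\theta_t\in\mathbb R$ with $\xi_t\ge0$, and set $$D_t(x)=x-Y_t+i\lambda_t,\qquad A_t(x)=\sqrt{2\lambda_t}\,e^{i\theta_t+i\xi_t(x-Y_t)}.$$ Suppose that $$b_t=\frac{N_t}{S_t},\qquad S_t=d_tD_t+r_t,\qquad N_t=d_tA_t+n_t,$$ with $d_t\in\mathbb C$ and functions $r_t,n_t$ of $x\in\mathbb R$, where, for some constants $c,d_0>0$, $$|d_t|\ge d_0,\qquad |S_t(x)|\ge c\,|d_tD_t(x)|,$$ and $$|d_t|^{-1}\|n_t/D_t\|_{L^2(\mathbb R)}\to0,\qquad \frac{\sqrt{\lambda_t}}{|d_t|}\|r_t/D_t^2\|_{L^2(\mathbb R)}\to0\qquad(t\to\infty).$$ Then $\|b_t-\mathcal M_{\lambda_t,Y_t,\xi_t,\theta_t}R\|_{L^2(\mathbb R)}\to0$ as $t\to\infty$.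
   Context: $L^2_+(\mathbb R)$, $H^s_+(\mathbb R)$: functions in $L^2$, $H^s$ with Fourier transform supported in $[0,\infty)$; $\Pi$ the orthogonal projection of $L^2$ onto $L^2_+$; $D=-i\partial_x$ as an operator. $R(x)=\frac{\sqrt2}{x+i}$, $[\mathcal M_{\lambda,y,\xi,\theta}f](x)=\lambda^{-1/2}e^{i\theta}e^{i\xi(x-y)}f(\frac{x-y}\lambda)$. For $v\in L^2_+$, $L_vf=-i\partial_xf-v\Pi(\bar vf)$ is the self-adjoint operator on $L^2_+$ with form domain $H^{1/2}_+$ (its point spectrum is finite and simple), with spectral measure $E_{L_v}$. A global flow--Lax admissible solution is a mass-preserving solution $u\in C([0,\infty);L^2_+)$ of $i\partial_tu+\partial_x^2u+(-i\partial_x+|\partial_x|)(|u|^2)u=0$ such that for each $T'<\infty$ there are smooth solutions $u_n\in C([0,T'];H^\infty_+)$ with $\sup_{0\le s\le T'}\|u_n(s)-u(s)\|_{L^2}\to0$. Its point channels are $b_j(t)=E_{L_{u(t)}}(\{\mu_j\})u(t)$, where $\sigma_{\rm p}(L_{u(0)})=\{\mu_1<\dots<\mu_N\}$. *)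

(* Defs.v *)
From HB Require Import structures.
From mathcomp Require Import all_boot all_order all_algebra.
From mathcomp Require Import all_classical all_reals all_analysis.
From mathcomp Require Import complex.
Set Implicit Arguments.
Unset Strict Implicit.
Unset Printing Implicit Defensive.
Import Order.TTheory GRing.Theory Num.Theory.
Import numFieldNormedType.Exports.
Local Open Scope classical_set_scope.
Local Open Scope ring_scope.

(* An element of L^2(R; C) is handled through its representatives
   f : R -> R[i]; equality in L^2 is [aeq].  A time-dependent function is
   u : R -> R -> R[i], with u t the function of x at time t; only times in the
   interval of interest are ever constrained. *)

Section Functions.
Context {R : realType}.
Implicit Types (f g h w v : R -> R[i]) (D : set R).

Local Notation leb := (@lebesgue_measure R).

Definition cmod (z : R[i]) : R := ComplexField.Normc.normc z.

Definition cis (a : R) : R[i] := Complex (cos a) (sin a).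

Definition cmeasurable f : Prop :=
  measurable_fun setT (fun x => complex.Re (f x)) /\
  measurable_fun setT (fun x => complex.Im (f x)).

Definition cintegrable D f : Prop :=
  leb.-integrable D (fun x => (complex.Re (f x))%:E) /\
  leb.-integrable D (fun x => (complex.Im (f x))%:E).

Definition cint D f : R[i] :=
  Complex (Rintegral leb D (fun x => complex.Re (f x)))
          (Rintegral leb D (fun x => complex.Im (f x))).

Definition aeq f g : Prop := {ae leb, forall x, f x = g x}.

Definition L2norm f : \bar R := Lnorm leb 2%:E (fun x => (cmod (f x))%:E).

Definition L2 f : Prop := cmeasurable f /\ (L2norm f < +oo)%E.

Definition dot f g : R[i] := cint setT (fun x => f x * conjc (g x)).

(* Fourier transform, normalized by fhat(xi) = \int e^{-i x xi} f(x) dx *)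

Definition fourier_on D f (xi : R) : R[i] :=
  cint D (fun x => cis (- (x * xi)) * f x).

Definition fourier1 f : R -> R[i] := fourier_on setT f.

(* On L^2 (Plancherel): the L^2 limit of the truncated transforms. *)
Definition is_fourier2 f g : Prop :=
  L2 g /\
  L2norm (fun xi => fourier_on `[- n%:R, n%:R]%classic f xi - g xi)
    @[n --> \oo] --> 0%E.

Definition fourier2 f : R -> R[i] := xget (fun=> 0) [set g | is_fourier2 f g].

Definition L2plus f : Prop :=
  L2 f /\ {ae leb, forall xi : R, xi < 0 -> fourier2 f xi = 0}.

Definition Hnorm (s : R) f : \bar R :=
  L2norm (fun xi => ((1 + xi ^+ 2) `^ (s / 2))%:C%C * fourier2 f xi).

Definition Hplus (s : R) f : Prop := L2plus f /\ (Hnorm s f < +oo)%E.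

Definition Hinfplus f : Prop := forall s : R, Hplus s f.

(* [is_szego w g] says g = Pi w: g is in L^2_+ and w - g is orthogonal to L^2_+.
   For w in L^2 every pairing below is integrable and this is the orthogonal
   projection.  The integrability proviso extends Pi to those w that are only in
   L^1, such as conj(v) f with v in L^2_+ and f in H^{1/2}_+ (for which Pi w is
   still in L^2). *)
Definition is_szego w g : Prop :=
  L2plus g /\
  forall h, L2plus h -> cintegrable setT (fun x => w x * conjc (h x)) ->
    dot w h = dot g h.

Definition szego w : R -> R[i] := xget (fun=> 0) [set g | is_szego w g].

(* Quadratic form of -i d/dx - v Pi(conj(v) .) on H^{1/2}_+. The first term is
   <-i f', g> written by Plancherel; the second uses
   <v Pi(conj(v) f), g> = <Pi(conj(v) f), Pi(conj(v) g)>. *)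
Definition lax_form v f g : R[i] :=
  ((2 * pi)^-1)%:C%C
    * cint setT (fun xi => xi%:C%C * fourier2 f xi * conjc (fourier2 g xi))
  - dot (szego (fun x => conjc (v x) * f x)) (szego (fun x => conjc (v x) * g x)).

(* An operator on L^2_+ is given by its graph: [T f h] says that f is in the
   domain and T f = h.  [lax v] is the operator associated with [lax_form v]. *)
Definition lax v f h : Prop :=
  [/\ Hplus (1 / 2) f, L2plus h &
      forall g, Hplus (1 / 2) g -> lax_form v f g = dot h g].

Definition point_spectrum (T : (R -> R[i]) -> (R -> R[i]) -> Prop) : set R :=
  [set m | exists f, [/\ L2plus f, ~ aeq f (fun=> 0) &
                         T f (fun x => m%:C%C * f x)]].

(* E is a projection-valued measure on L^2_+ and, for f in L^2_+, m f is the
   scalar measure A |-> |E(A) f|^2 = <E(A) f, f>. *)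
Definition is_pvm (E : set R -> (R -> R[i]) -> (R -> R[i]))
    (m : (R -> R[i]) -> {measure set (measurableTypeR R) -> \bar R}) : Prop :=
  [/\ forall (A : set (measurableTypeR R)) f,
        measurable A -> L2plus f -> L2plus (E A f),
      forall (A : set (measurableTypeR R)) f g,
        measurable A -> L2plus f -> L2plus g -> dot (E A f) g = dot f (E A g),
      forall (A B : set (measurableTypeR R)) f,
        measurable A -> measurable B -> L2plus f ->
        aeq (E (A `&` B) f) (E A (E B f)),
      forall f, L2plus f -> aeq (E setT f) f &
      forall (A : set (measurableTypeR R)) f,
        measurable A -> L2plus f -> m f A = (L2norm (E A f) `^ 2)%E].

(* E is the spectral measure of the self-adjoint operator T, i.e.
   T = \int s dE(s), with domain {f | \int s^2 d|E(s) f|^2 < oo}; by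
   polarization the diagonal values <T f, f> suffice. *)
Definition is_spectral_measure (T : (R -> R[i]) -> (R -> R[i]) -> Prop)
    (E : set R -> (R -> R[i]) -> (R -> R[i])) : Prop :=
  exists m, is_pvm E m /\
    forall f, L2plus f ->
      ((exists h, T f h) <-> (\int[m f]_s (s ^+ 2)%:E < +oo)%E) /\
      (forall h, T f h -> dot h f = (Rintegral (m f) setT (fun s => s))%:C%C).

(* Fourier transform of (-i d/dx + |d/dx|)(|w|^2) w for w in L^2_+: the first
   factor has transform (xi + |xi|) (|w|^2)^(xi), and the product becomes a
   convolution, whose integrand vanishes a.e. outside [0, zeta]. *)
Definition nonlin_hat w (zeta : R) : R[i] :=
  ((2 * pi)^-1)%:C%C
    * cint setT (fun xi => (xi + `|xi|)%:C%C
                           * fourier1 (fun x => (cmod (w x) ^+ 2)%:C%C) xi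
                           * fourier2 w (zeta - xi)).

(* i u_t + u_xx + (-i d/dx + |d/dx|)(|u|^2) u = 0 on the time interval I
   (containing 0), tested against functions whose Fourier transform psi is
   continuous with compact support, and integrated in time. *)
Definition solves_flow (I : set R) (u : R -> R -> R[i]) : Prop :=
  forall psi : R -> R, continuous psi ->
  (exists M : R, forall z, M < `|z| -> psi z = 0) ->
  forall t, I t ->
  'i%C * (cint setT (fun z => (psi z)%:C%C * fourier2 (u t) z)
          - cint setT (fun z => (psi z)%:C%C * fourier2 (u 0) z))
  = cint `[0, t]%classic (fun s => cint setT (fun z =>
      (psi z)%:C%C * ((z ^+ 2)%:C%C * fourier2 (u s) z - nonlin_hat (u s) z))).

Definition time_continuous (I : set R) (nrm : (R -> R[i]) -> \bar R)
    (u : R -> R -> R[i]) : Prop :=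
  forall t, I t ->
    nrm (fun x => u s x - u t x) @[s --> within I (nbhs t)] --> 0%E.

Definition smooth_solution (I : set R) (u : R -> R -> R[i]) : Prop :=
  [/\ forall t, I t -> Hinfplus (u t),
      forall s : R, time_continuous I (Hnorm s) u &
      solves_flow I u].

Definition flow_lax_admissible (u : R -> R -> R[i]) : Prop :=
  [/\ forall t, 0 <= t -> L2plus (u t),
      time_continuous `[0, +oo[%classic L2norm u,
      forall t, 0 <= t -> L2norm (u t) = L2norm (u 0),
      solves_flow `[0, +oo[%classic u &
      forall T' : R, 0 < T' ->
        exists un : nat -> R -> R -> R[i],
          (forall n, smooth_solution `[0, T']%classic (un n)) /\
          ereal_sup [set L2norm (fun x => un n s x - u s x)
                    | s in `[0, T']%classic] @[n --> \oo] --> 0%E].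

Definition enumerates_point_spectrum
    (T : (R -> R[i]) -> (R -> R[i]) -> Prop) (N : nat) (mu : 'I_N -> R) : Prop :=
  (forall i j : 'I_N, (i < j)%N -> mu i < mu j) /\ range mu = point_spectrum T.

Definition is_point_channel (u : R -> R -> R[i]) (m : R) (b : R -> R -> R[i])
    : Prop :=
  forall t, 0 <= t ->
    exists E, is_spectral_measure (lax (u t)) E /\ b t = E [set m] (u t).

Definition Rsol (x : R) : R[i] := (Num.sqrt 2)%:C%C / Complex x 1.

Definition modul (lam y xi theta : R) f (x : R) : R[i] :=
  (lam `^ (- (1 / 2)))%:C%C * cis theta * cis (xi * (x - y)) * f ((x - y) / lam).

Definition Dden (lam Y x : R) : R[i] := Complex (x - Y) lam.

Definition Aamp (lam Y xi theta x : R) : R[i] :=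
  (Num.sqrt (2 * lam))%:C%C * cis (theta + xi * (x - Y)).

End Functions.

(* Main.v *)
Require Import Defs.
From HB Require Import structures.
From mathcomp Require Import all_boot all_order all_algebra.
From mathcomp Require Import all_classical all_reals all_analysis.
From mathcomp Require Import complex.
From mathcomp Require Import measurable_realfun ring.
Set Implicit Arguments.
Unset Strict Implicit.
Unset Printing Implicit Defensive.
Import Order.TTheory GRing.Theory Num.Theory.
Import numFieldNormedType.Exports.
Local Open Scope classical_set_scope.
Local Open Scope ring_scope.

(** Write [D], [A], [S = d D + r] for the functions of [x] at a fixed time.
    Because the pole of the profile [sqrt 2 / (x + i)] is carried by the
    dilation and translation to the zero of [D], the modulated profile is
    exactly [A / D] ([modul_RsolE]).  The channel is [(d A + n) / S], so that
    the leading terms cancel: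
      [(d A + n) / S - A / D = n / S - A r / (D S)].
    The lower bound [|S| >= c |d D|] and the constancy of
    [|A| = sqrt (2 lambda)] turn this identity into the pointwise estimate
    ([quotient_perturbation])
      [|b - A/D| <= c^-1 |d|^-1 |n / D|
                    + c^-1 sqrt (2 lambda) |d|^-1 |r / D^2|].
    Minkowski's inequality ([le_L2norm_comb]) then bounds the L^2 distance
    by constant multiples of the two quantities assumed to vanish as time
    tends to infinity, and a squeeze concludes. *)

(** * Modulus and phase of complex numbers *)

Section ComplexModulus.
Context {R : realType}.
Implicit Types z w : R[i].

Lemma cmodE z : cmod z = Num.sqrt (complex.Re z ^+ 2 + complex.Im z ^+ 2).
Proof. by case: z. Qed.

Lemma cmod_ge0 z : 0 <= cmod z.
Proof. by rewrite cmodE sqrtr_ge0. Qed.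

Lemma cmodM z w : cmod (z * w) = cmod z * cmod w.
Proof. exact: ComplexField.Normc.normcM. Qed.

Lemma cmodV z : cmod z^-1 = (cmod z)^-1.
Proof. exact: ComplexField.Normc.normcV. Qed.

Lemma ler_cmodB z w : cmod (z - w) <= cmod z + cmod w.
Proof. by rewrite -[cmod w]complex.normcN; exact: complex.le_normcD. Qed.

Lemma cmod_gt0 z : (0 < cmod z) = (z != 0).
Proof.
rewrite lt_neqAle cmod_ge0 andbT eq_sym; congr negb; apply/eqP/eqP => [|->].
  exact: ComplexField.Normc.eq0_normc.
exact: ComplexField.Normc.normc0.
Qed.

Lemma cmod_real (a : R) : 0 <= a -> cmod a%:C%C = a.
Proof. by move=> a0; rewrite cmodE /= expr0n /= addr0 sqrtr_sqr ger0_norm. Qed.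

Lemma cmod_cis (a : R) : cmod (cis a) = 1.
Proof. by rewrite cmodE /= cos2Dsin2 sqrtr1. Qed.

Lemma cisD (a b : R) : cis (a + b) = cis a * cis b.
Proof.
apply/eqP; rewrite eq_complex /cis /= cosD sinD !eqxx /=.
by rewrite addrC (mulrC (sin a)) addrC eqxx.
Qed.

End ComplexModulus.

(** * Measurability of complex-valued functions *)

Section ComplexMeasurability.
Context {R : realType}.
Implicit Types f g : R -> R[i].

Lemma measurable_cmod f : cmeasurable f -> measurable_fun setT (fun x => cmod (f x)).
Proof.
move=> [mre mim]; under eq_fun do rewrite cmodE.
have msqrt : measurable_fun [set: R] (@Num.sqrt R).
  by apply: continuous_measurable_fun; exact: sqrt_continuous.
apply: (measurableT_comp msqrt).
by apply: measurable_funD; exact: measurable_funX.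
Qed.

Lemma cmeasurableB f g : cmeasurable f -> cmeasurable g ->
  cmeasurable (fun x => f x - g x).
Proof.
move=> [f1 f2] [g1 g2]; split.
  have -> : (fun x => complex.Re (f x - g x))
      = (fun x => complex.Re (f x) - complex.Re (g x)).
    by apply/funext => x; case: (f x) (g x) => [? ?] [].
  exact: measurable_funB.
have -> : (fun x => complex.Im (f x - g x))
    = (fun x => complex.Im (f x) - complex.Im (g x)).
  by apply/funext => x; case: (f x) (g x) => [? ?] [].
exact: measurable_funB.
Qed.

Lemma cmeasurableM f g : cmeasurable f -> cmeasurable g ->
  cmeasurable (fun x => f x * g x).
Proof.
move=> [f1 f2] [g1 g2]; split.
  have -> : (fun x => complex.Re (f x * g x)) = (fun x => complex.Re (f x)
      * complex.Re (g x) - complex.Im (f x) * complex.Im (g x)).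
    by apply/funext => x; case: (f x) (g x) => [? ?] [].
  by apply: measurable_funB; exact: measurable_funM.
have -> : (fun x => complex.Im (f x * g x)) = (fun x => complex.Re (f x)
    * complex.Im (g x) + complex.Im (f x) * complex.Re (g x)).
  by apply/funext => x; case: (f x) (g x) => [? ?] [].
by apply: measurable_funD; exact: measurable_funM.
Qed.

(** The inverse is handled through real and imaginary parts divided by the
    squared modulus; as [powR] at exponent -1, the real inverse is measurable
    on nonnegative arguments, zero included, so [f] may vanish. *)
Lemma cmeasurableV f : cmeasurable f -> cmeasurable (fun x => (f x)^-1).
Proof.
move=> [f1 f2].
have mq : measurable_fun setT
    (fun x => (complex.Re (f x) ^+ 2 + complex.Im (f x) ^+ 2)^-1).
  under eq_fun do rewrite -powR_inv1 ?addr_ge0 ?sqr_ge0//.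
  apply: (measurableT_comp (measurable_powR (-1))).
  by apply: measurable_funD; exact: measurable_funX.
split.
  have -> : (fun x => complex.Re (f x)^-1) = (fun x => complex.Re (f x)
      * (complex.Re (f x) ^+ 2 + complex.Im (f x) ^+ 2)^-1).
    by apply/funext => x; case: (f x).
  exact: (measurable_funM f1 mq).
have -> : (fun x => complex.Im (f x)^-1) = (fun x => - complex.Im (f x)
    * (complex.Re (f x) ^+ 2 + complex.Im (f x) ^+ 2)^-1).
  by apply/funext => x; case: (f x) => ? ?; rewrite mulNr.
exact: (measurable_funM (measurable_funN f2) mq).
Qed.

Lemma cmeasurable_cst (z : R[i]) : cmeasurable (fun=> z).
Proof. by split; exact: measurable_cst. Qed.

Lemma cmeasurable_Dden (l y : R) : cmeasurable (Dden l y).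
Proof. by split; [exact: measurable_funB | exact: measurable_cst]. Qed.

Lemma cmeasurable_Aamp (l y xi theta : R) : cmeasurable (Aamp l y xi theta).
Proof.
apply: cmeasurableM; first exact: cmeasurable_cst.
have mphase : measurable_fun setT (fun x : R => theta + xi * (x - y)).
  by apply: measurable_funD => //; apply: measurable_funM => //;
    exact: measurable_funB.
split; apply: (measurableT_comp _ mphase).
- by apply: continuous_measurable_fun; exact: continuous_cos.
- by apply: continuous_measurable_fun; exact: continuous_sin.
Qed.

End ComplexMeasurability.

(** * Domination in the L2 norm *)

Section L2normBounds.
Context {R : realType}.
Implicit Types f g h : R -> R[i].
Local Notation leb := (@lebesgue_measure R).

Lemma le_Lnorm2_ae (p q : R -> R) : measurable_fun setT p ->
  measurable_fun setT q -> (forall x, 0 <= p x) ->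
  {ae leb, forall x, p x <= q x} ->
  (Lnorm leb 2%:E (EFin \o p) <= Lnorm leb 2%:E (EFin \o q))%E.
Proof.
move=> mp mq p0 pq.
have msq (k : R -> R) : measurable_fun setT k ->
    measurable_fun setT (fun x => (`|(k x)%:E| `^ 2)%E).
  move=> mk; apply: (measurableT_comp (measurable_poweR 2)).
  by apply: measurableT_comp => //; exact/measurable_EFinP.
have ge0sq (k : R -> R) x : (0 <= `|(k x)%:E| `^ 2)%E by exact: poweR_ge0.
rewrite unlock /=; apply: gt0_ler_poweR; first by rewrite invr_ge0.
- by rewrite in_itv /= leey andbT integral_ge0.
- by rewrite in_itv /= leey andbT integral_ge0.
apply: ae_ge0_le_integral => //; try exact: msq.
have aeF := ae_filter_ringOfSetsType leb.
apply: filterS pq => x pqx _.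
have q0 := le_trans (p0 x) pqx.
by rewrite lee_fin !ger0_norm// ge0_ler_powR ?nnegrE.
Qed.

Lemma Lnorm2Zl (a : R) (p : R -> R) : 0 <= a -> measurable_fun setT p ->
  Lnorm leb 2%:E (EFin \o (fun x => a * p x))
  = (a%:E * Lnorm leb 2%:E (EFin \o p))%E.
Proof.
move=> a0 mp; rewrite unlock /=.
under eq_integral do rewrite normrM (ger0_norm a0) powRM// EFinM.
have mpsq : measurable_fun setT (fun x => (`|p x| `^ 2)%:E).
  apply/measurable_EFinP; apply: (measurableT_comp (measurable_powR 2)).
  exact: measurableT_comp.
rewrite ge0_integralZl//; last by rewrite lee_fin powR_ge0.
rewrite poweRM ?lee_fin ?powR_ge0//; last first.
  by apply: integral_ge0 => x _; rewrite lee_fin powR_ge0.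
by rewrite poweR_EFin -powRrM mulfV// powRr1.
Qed.

(** Minkowski's inequality is applied to the real functions [a |g|] and
    [b |h|], not to complex sums, so that [f] enters only through an almost
    everywhere bound on its modulus and need not split as a sum. *)
Lemma le_L2norm_comb f g h (a b : R) : 0 <= a -> 0 <= b ->
  cmeasurable f -> cmeasurable g -> cmeasurable h ->
  {ae leb, forall x, cmod (f x) <= a * cmod (g x) + b * cmod (h x)} ->
  (L2norm f <= a%:E * L2norm g + b%:E * L2norm h)%E.
Proof.
move=> a0 b0 /measurable_cmod mf /measurable_cmod mg /measurable_cmod mh fgh.
have mag := measurable_funM (measurable_cst a) mg.
have mbh := measurable_funM (measurable_cst b) mh.
rewrite /L2norm -(Lnorm2Zl a0 mg) -(Lnorm2Zl b0 mh).
have le12 : 1 <= 2 :> R by rewrite ler1n.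
apply: le_trans; last exact: (minkowski_EFin leb mag mbh le12).
apply: le_Lnorm2_ae => //.
- exact: measurable_funD.
- by move=> x; exact: cmod_ge0.
Qed.

End L2normBounds.

(** * The soliton as a quotient and its perturbations *)

Section SolitonQuotient.
Context {R : realType}.

(** Since [D = lambda ((x - y) / lambda + i)] and
    [sqrt (2 lambda) / lambda = lambda^(-1/2) sqrt 2], the normalizations
    of the two sides agree. *)
Lemma modul_RsolE (l y xi theta x : R) : 0 < l ->
  modul l y xi theta Rsol x = Aamp l y xi theta x / Dden l y x.
Proof.
move=> l0.
have DE : Dden l y x = l%:C%C * Complex ((x - y) / l) 1.
  have l_neq0 : l != 0 by rewrite gt_eqF.
  by apply/eqP; rewrite eq_complex /=; apply/andP; split; apply/eqP; field.
have sqrtlE : Num.sqrt l = l `^ (- (1 / 2)) * l.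
  rewrite -[X in _ = _ * X](powRr1 (ltW l0)) -powRD ?(gt_eqF l0) ?implybT//.
  by rewrite -powR12_sqrt ?ltW//; congr (_ `^ _); field.
have sqrtE : (Num.sqrt (2 * l))%:C%C
    = (l `^ (- (1 / 2)))%:C%C * (Num.sqrt 2)%:C%C * l%:C%C :> R[i].
  rewrite -!rmorphM /=; congr (_%:C%C).
  by rewrite sqrtrM// sqrtlE mulrCA mulrA.
have ln0 : (l%:C)%C != 0 :> R[i].
  by rewrite eq_complex /= eqxx andbT gt_eqF.
rewrite /modul /Rsol /Aamp DE sqrtE cisD invfM.
set w := (Complex _ _)^-1.
by field.
Qed.

Lemma Dden_neq0 (l y x : R) : 0 < l -> Dden l y x != 0.
Proof. by move=> l0; rewrite eq_complex /= negb_and orbC gt_eqF. Qed.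

(** The error equals [n / S - A r / (D S)] with [S = d D + r]: the large terms
    [d A / S] and [A / D] differ only through [S - d D = r].  Bounding [1 / S]
    by [1 / (c |d D|)] then produces one factor [1 / D] next to [n] and two
    next to [r]. *)
Lemma quotient_perturbation (c : R) (d A D r n : R[i]) : 0 < c ->
  d != 0 -> D != 0 -> c * cmod (d * D) <= cmod (d * D + r) ->
  cmod ((d * A + n) / (d * D + r) - A / D)
  <= c^-1 * (cmod d)^-1 * cmod (n / D)
     + c^-1 * (cmod A / cmod d) * cmod (r / D ^+ 2).
Proof.
move=> c0 d0 D0 lb; set S := d * D + r in lb *.
have dgt0 : 0 < cmod d by rewrite cmod_gt0.
have Dgt0 : 0 < cmod D by rewrite cmod_gt0.
have cdD : 0 < c * cmod (d * D) by rewrite cmodM !mulr_gt0.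
have S0 : S != 0 by rewrite -cmod_gt0 (lt_le_trans cdD).
have -> : (d * A + n) / S - A / D = n / S - A * r / (D * S).
  have -> : r = S - d * D by rewrite /S addrC addKr.
  by field; apply/andP.
apply: le_trans (ler_cmodB _ _) _.
have SV : cmod S^-1 <= c^-1 * (cmod d)^-1 * (cmod D)^-1.
  by rewrite cmodV -mulrA -!invfM -cmodM lef_pV2 ?posrE// (lt_le_trans cdD).
apply: lerD.
- by rewrite !cmodM (cmodV D) [leRHS]mulrCA ler_wpM2l ?cmod_ge0.
- have -> : c^-1 * (cmod A / cmod d) * cmod (r / D ^+ 2)
      = cmod A * cmod r * (cmod D)^-1 * (c^-1 * (cmod d)^-1 * (cmod D)^-1).
    rewrite expr2 !(cmodM, cmodV); field.
    by rewrite !gt_eqF.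
  rewrite invfM mulrA !cmodM (cmodV D).
  by rewrite ler_wpM2l // !mulr_ge0 ?invr_ge0 ?cmod_ge0.
Qed.

Lemma cmod_Aamp (l y xi theta x : R) :
  cmod (Aamp l y xi theta x) = Num.sqrt (2 * l).
Proof. by rewrite cmodM cmod_cis mulr1 cmod_real ?sqrtr_ge0. Qed.

End SolitonQuotient.

(** * Convergence of the point channel *)

(** Spectral projections map the Hardy space to itself, and membership in the
    Hardy space includes measurability.  This is what makes the integral in
    the L2 norm of [b t] monotone under almost everywhere bounds. *)
Lemma cmeasurable_point_channel (R : realType) (u b : R -> R -> R[i]) (m t : R) :
  L2plus (u t) -> is_point_channel u m b -> 0 <= t -> cmeasurable (b t).
Proof.
move=> ut bch t0; have [E [[mE [[EL2 _ _ _ _] _]] ->]] := bch t t0.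
by have [[]] := EL2 [set m] (u t) (measurable_set1 m) ut.
Qed.

Theorem proposition5p25 (R : realType)
  (u : R -> R -> R[i]) (u_adm : flow_lax_admissible u)
  (N : nat) (mu : 'I_N -> R)
  (mu_spec : enumerates_point_spectrum (lax (u 0)) mu)
  (j : 'I_N) (b : R -> R -> R[i]) (b_channel : is_point_channel u (mu j) b)
  (lam Y xi theta : R -> R)
  (lam_gt0 : forall t, 0 <= t -> 0 < lam t)
  (xi_ge0 : forall t, 0 <= t -> 0 <= xi t)
  (d : R -> R[i]) (r n S Nu : R -> R -> R[i])
  (r_meas : forall t, 0 <= t -> cmeasurable (r t))
  (n_meas : forall t, 0 <= t -> cmeasurable (n t))
  (S_def : forall t x, 0 <= t -> S t x = d t * Dden (lam t) (Y t) x + r t x)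
  (Nu_def : forall t x, 0 <= t ->
     Nu t x = d t * Aamp (lam t) (Y t) (xi t) (theta t) x + n t x)
  (b_eq : forall t, 0 <= t -> aeq (b t) (fun x => Nu t x / S t x))
  (c d0 : R) (c_gt0 : 0 < c) (d0_gt0 : 0 < d0)
  (d_lb : forall t, 0 <= t -> d0 <= cmod (d t))
  (S_lb : forall t x, 0 <= t ->
     c * cmod (d t * Dden (lam t) (Y t) x) <= cmod (S t x))
  (n_small : (((cmod (d t))^-1)%:E
                * L2norm (fun x => n t x / Dden (lam t) (Y t) x)%R)%E
     @[t --> +oo] --> 0%E)
  (r_small : ((Num.sqrt (lam t) / cmod (d t))%:E
                * L2norm (fun x => r t x / (Dden (lam t) (Y t) x) ^+ 2)%R)%E
     @[t --> +oo] --> 0%E) :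
  L2norm (fun x => b t x - modul (lam t) (Y t) (xi t) (theta t) Rsol x)
    @[t --> +oo] --> 0%E.
Proof.
have [uL2 _ _ _ _] := u_adm.
have bound t : 0 <= t ->
    (L2norm (fun x => b t x - modul (lam t) (Y t) (xi t) (theta t) Rsol x)%R
     <= (c^-1)%:E * (((cmod (d t))^-1)%:E
          * L2norm (fun x => n t x / Dden (lam t) (Y t) x)%R)
        + (c^-1 * Num.sqrt 2)%:E * ((Num.sqrt (lam t) / cmod (d t))%:E
          * L2norm (fun x => r t x / (Dden (lam t) (Y t) x) ^+ 2)%R))%E.
  move=> t0; have lt0 := lam_gt0 _ t0.
  have dn0 : d t != 0 by rewrite -cmod_gt0 (lt_le_trans d0_gt0) ?d_lb.
  have mDV := cmeasurableV (cmeasurable_Dden (lam t) (Y t)).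
  rewrite !muleA -!EFinM; apply: le_L2norm_comb.
  - by rewrite mulr_ge0 // invr_ge0 ?cmod_ge0 // ltW.
  - by rewrite !mulr_ge0 // ?invr_ge0 ?cmod_ge0 ?sqrtr_ge0 // ltW.
  - apply: cmeasurableB; first exact: (cmeasurable_point_channel (uL2 _ t0) b_channel t0).
    rewrite (_ : modul _ _ _ _ _ = fun x =>
      Aamp (lam t) (Y t) (xi t) (theta t) x / Dden (lam t) (Y t) x); last first.
      by apply/funext => x; exact: modul_RsolE.
    by apply: cmeasurableM => //; exact: cmeasurable_Aamp.
  - by apply: cmeasurableM => //; exact: n_meas.
  - apply: cmeasurableM; first exact: r_meas.
    by apply/cmeasurableV/cmeasurableM; exact: cmeasurable_Dden.
  have aeF := ae_filter_ringOfSetsType (@lebesgue_measure R).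
  apply: filterS (b_eq _ t0) => x bx.
  rewrite bx modul_RsolE// Nu_def// S_def//.
  have lb : c * cmod (d t * Dden (lam t) (Y t) x)
      <= cmod (d t * Dden (lam t) (Y t) x + r t x) by rewrite -S_def// S_lb.
  have := quotient_perturbation (Aamp (lam t) (Y t) (xi t) (theta t) x)
    (n t x) c_gt0 dn0 (Dden_neq0 (Y t) x lt0) lb.
  by rewrite cmod_Aamp sqrtrM// !mulrA.
apply: (@squeeze_cvge _ _ _ _ (cst 0%E)); [|exact: cvg_cst|].
- near=> t; rewrite /cst Lnorm_ge0 /=; apply: bound.
  by near: t; exact: nbhs_pinfty_ge.
- rewrite -[X in _ --> X]adde0 -[X in _ --> (X + _)%E](mule0 (c^-1)%:E).
  rewrite -[X in _ --> (_ + X)%E](mule0 (c^-1 * Num.sqrt 2)%:E).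
  apply: cvgeD; [|exact: cvgeZl|exact: cvgeZl].
  by rewrite !mule0.
Unshelve. all: by end_near.
Qed.
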